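(* Let $a \ge 1$ and $n \ge 1$ be integers. The function $\Phi_n$, $\Phi_n(k) = \lfloor n/k \rfloor$, maps the set $\mathcal{Q}_a^+(n)$ injectively into the set $\mathcal{Q}_a^-(n)$. Consequently, for all $n \ge 1$, $$|\mathcal{Q}_a^+(n)| \le |\mathcal{Q}_a^-(n)|.$$
   Context: For positive integers $d, n$, one writes $d \preccurlyeq_1 n$ if $d = \lfloor n/k \rfloor$ for some positive integer $k$. For an integer $a \ge 1$, one writes $d \preccurlyeq_a n$ (''$d$ is an $a$-floor quotient of $n$'') if and only if $ad \preccurlyeq_1 an$, i.e. there is a positive integer $k$ with $ad = \lfloor an/k \rfloor$. Set $\mathcal{Q}_a[1,n] = \{d \in \mathbb{N}^+ : d \preccurlyeq_a n\}$, and $$\mathcal{Q}_a^-(n) = \{d \in \mathcal{Q}_a[1,n] : d \le \sqrt{n}\}, \qquad \mathcal{Q}_a^+(n) = \{d \in \mathcal{Q}_a[1,n] : \lfloor n/d \rfloor \le \sqrt{n}\}.$$ The $n$-floor reciprocal map is $\Phi_n : \{1,\ldots,n\} \to \{1,\ldots,n\}$, $\Phi_n(k) = \lfloor n/k \rfloor$. $|\cdot|$ denotes cardinality. *)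

(* Defs.v *)
From mathcomp Require Import all_boot all_order all_algebra finmap.
From mathcomp Require Import boolp classical_sets functions cardinality reals.
Set Implicit Arguments.
Unset Strict Implicit.
Unset Printing Implicit Defensive.
Local Open Scope nat_scope.
Local Open Scope classical_set_scope.

(* The relation is only meant for d, n > 0, where floor(n/k) is n %/ k. *)
Definition floor_quotient1 (d n : nat) : Prop :=
  exists2 k : nat, 0 < k & d = n %/ k.

Definition floor_quotient (a d n : nat) : Prop :=
  floor_quotient1 (a * d) (a * n).

Definition Q (a n : nat) : set nat :=
  [set d | 0 < d /\ floor_quotient a d n].

Definition Qminus (R : realType) (a n : nat) : set nat :=
  [set d | Q a n d /\ (d%:R <= Num.sqrt (n%:R : R))%R].

Definition Qplus (R : realType) (a n : nat) : set nat :=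
  [set d | Q a n d /\ ((n %/ d)%:R <= Num.sqrt (n%:R : R))%R].

(* Total on nat; the floor reciprocal map is its restriction to {1, ..., n},
   see Phi_range. *)
Definition Phi (n k : nat) : nat := n %/ k.

Lemma Phi_range (n k : nat) : 0 < k <= n -> 0 < Phi n k <= n.
Proof. by move=> /andP[k0 kn]; rewrite /Phi divn_gt0 // kn leq_div. Qed.

Lemma Q_range (a n d : nat) : 0 < a -> Q a n d -> 0 < d <= n.
Proof.
move=> a0 [d0 [k _ e]]; rewrite d0 /=.
by rewrite -(leq_pmul2l a0) e leq_div.
Qed.

(* fset_set is only meaningful on finite sets; the next three lemmas ensure
   that #|` fset_set (Qplus R a n)| and #|` fset_set (Qminus R a n)| are
   genuine cardinalities. *)
Lemma Q_finite (a n : nat) : 0 < a -> finite_set (Q a n).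
Proof.
move=> a0; apply: (sub_finite_set _ (finite_II n.+1)) => d /(Q_range a0).
by move=> /andP[].
Qed.

Lemma Qminus_finite (R : realType) (a n : nat) :
  0 < a -> finite_set (Qminus R a n).
Proof. by move=> a0; apply: sub_finite_set (Q_finite n a0) => d []. Qed.

Lemma Qplus_finite (R : realType) (a n : nat) :
  0 < a -> finite_set (Qplus R a n).
Proof. by move=> a0; apply: sub_finite_set (Q_finite n a0) => d []. Qed.

(* Main.v *)
Require Import Defs.
From mathcomp Require Import all_boot all_order all_algebra finmap.
From mathcomp Require Import boolp classical_sets functions cardinality reals.
Local Open Scope nat_scope.
Local Open Scope classical_set_scope.

(** Call [k > 0] a cutting length of [d] when [a * d = (a * n) %/ k].  If an
    [a]-floor quotient [d] of [n] has cutting length [k], then [k <= e] for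
    [e = n %/ d], so [a * n < (a * d + 1) * k] still holds with [e] for [k];
    as [a * d * e <= a * n], [e] is a cutting length of [d] too.  So
    [a * d = (a * n) %/ e] ([floor_quotient_divE]), and [d] is recovered from
    [e]: [Phi n] is injective on all of [Q a n].

    For [e] itself to be an [a]-floor quotient, take [f = n %/ e] as cutting
    length.  The bound [a * e * f <= a * n] is automatic.  For the strict upper
    bound, [a * n < a * d * e + e] by the above; [d <= f] because
    [d * e <= n], and [e <= f] because [e <= sqrt n], whence
    [a * n < a * e * f + f].  Membership in [Qplus] enters only through
    [e <= f]; it also gives the size bound in [Qminus] directly. *)

Lemma divn_uniq (m q k : nat) : q * k <= m < q.+1 * k -> m %/ k = q.
Proof.
case: k => [|k] /andP[lb ub]; first by rewrite muln0 in ub.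
by apply/eqP; rewrite eqn_leq -ltnS ltn_divLR // ub leq_divRL.
Qed.

Lemma Q_div_gt0 (a n d : nat) : 0 < a -> Q a n d -> 0 < n %/ d.
Proof. by move=> a0 /(Q_range a0)/andP[d0 dn]; rewrite divn_gt0. Qed.

(** No cutting length of [d] exceeds [n %/ d], and the upper bound only
    gets weaker as the cutting length grows. *)
Lemma Q_upper_bound (a n d : nat) :
  0 < a -> Q a n d -> a * n < (a * d).+1 * (n %/ d).
Proof.
move=> a0 [d0 [k k0 adE]].
have k_le : k <= n %/ d.
  by rewrite leq_divRL // mulnC -(leq_pmul2l a0) mulnA adE leq_divM.
by apply: leq_trans (leq_mul (leqnn _) k_le); rewrite adE ltn_ceil.
Qed.

(** This canonical choice of cutting length determines [d] from [n %/ d], so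
    it makes the floor reciprocal map injective on [Q a n]. *)
Lemma floor_quotient_divE (a n d : nat) :
  0 < a -> Q a n d -> a * d = (a * n) %/ (n %/ d).
Proof.
move=> a0 Qd; apply/esym/divn_uniq; rewrite Q_upper_bound // andbT.
by rewrite -mulnA leq_mul2l mulnC leq_divM orbT.
Qed.

Lemma Phi_inj (a n : nat) : 0 < a -> set_inj (Q a n) (Phi n).
Proof.
move=> a0 d1 d2 /set_mem Q1 /set_mem Q2; rewrite /Phi => e12.
apply/eqP; rewrite -(eqn_pmul2l a0); apply/eqP.
by rewrite (floor_quotient_divE _ _ _ a0 Q1) e12 -floor_quotient_divE.
Qed.

(** The number [n %/ (n %/ d)] dominates both [d] and [n %/ d], so the upper
    bound that holds for [d] with cutting length [n %/ d] implies the one for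
    [n %/ d] with cutting length [n %/ (n %/ d)]. *)
Lemma Q_Phi (a n d : nat) :
  0 < a -> Q a n d -> (n %/ d) ^ 2 <= n -> Q a n (Phi n d).
Proof.
rewrite /Phi => a0 Qd; set e := n %/ d => e2n.
have e0 : 0 < e := Q_div_gt0 _ _ _ a0 Qd.
have d_le : d <= n %/ e by rewrite leq_divRL // mulnC leq_divM.
have e_le : e <= n %/ e by rewrite leq_divRL // mulnn.
split=> //; exists (n %/ e); first exact: leq_trans e0 e_le.
apply/esym/divn_uniq/andP; split.
  by rewrite -mulnA leq_mul2l mulnC leq_divM orbT.
apply: leq_trans (Q_upper_bound _ _ _ a0 Qd) _; rewrite -/e !mulSn.
by rewrite leq_add // mulnAC leq_mul2l d_le orbT.
Qed.

Lemma nat_le_sqrt (R : realType) (m n : nat) :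
  (m%:R <= Num.sqrt (n%:R : R))%R = (m ^ 2 <= n).
Proof.
rewrite -[LHS]Num.Theory.ler_sqr ?qualifE /= ?Num.Theory.ler0n //.
  by rewrite Num.Theory.sqr_sqrtr ?Num.Theory.ler0n // -GRing.natrX
             Num.Theory.ler_nat.
exact: Num.Theory.sqrtr_ge0.
Qed.

Lemma set_inj_card_fset_set (T U : choiceType) (f : T -> U)
    (A : set T) (B : set U) :
  finite_set A -> finite_set B -> set_fun A B f -> set_inj A f ->
  #|` fset_set A| <= #|` fset_set B|.
Proof.
move=> finA finB fAB f_inj.
have <- : #|` [fset f x | x in fset_set A]%fset| = #|` fset_set A|.
  apply: card_in_imfset => x y /=; rewrite !in_fset_set // => xA yA.
  exact: f_inj.
apply: fsubset_leq_card; apply/fsubsetP => _ /imfsetP[x /= xA ->].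
by move: xA; rewrite !in_fset_set // => /set_mem xA; apply/mem_set/fAB.
Qed.

Theorem lemma5p1 (R : realType) (a n : nat) (ha : 1 <= a) (hn : 1 <= n) :
  [/\ set_fun (Qplus R a n) (Qminus R a n) (Phi n),
      set_inj (Qplus R a n) (Phi n)
    & #|` fset_set (Qplus R a n)| <= #|` fset_set (Qminus R a n)| ].
Proof.
have Phi_fun : set_fun (Qplus R a n) (Qminus R a n) (Phi n).
  by move=> d [Qd dn]; split=> //; apply: Q_Phi; rewrite // -(nat_le_sqrt R).
have Phi_inj_plus : set_inj (Qplus R a n) (Phi n).
  move=> d1 d2 /set_mem[Q1 _] /set_mem[Q2 _].
  by apply: (Phi_inj _ _ ha); apply/mem_set.
split=> //.
by apply: set_inj_card_fset_set Phi_fun Phi_inj_plus;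
  [exact: Qplus_finite | exact: Qminus_finite].
Qed.
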